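(* Let $\theta>0$ and $1\le p,q<\infty$. Then the grand amalgam Lebesgue function space $l^{q),\theta}(L^p)$ is a Banach space with respect to the norm $\|\cdot\|_{p,q),\theta}$.
   Context: Let $X$ denote one of $\mathbb N$, $\mathbb N_0$ or $\mathbb Z$, and for $k\in X$ let $I_k=[k,k+1)$. For $1\le p,q<\infty$ and $\theta>0$, $l^{q),\theta}(L^p)$ is the set of all complex-valued measurable functions $g$ on $\bigcup_{k\in X}I_k$ with $g\chi_{I_k}\in L^p$ for each $k\in X$ and $$\|g\|_{p,q),\theta}:=\sup_{\varepsilon>0}\Big(\varepsilon^{\theta}\sum_{k\in X}\Big(\int_k^{k+1}|g(x)|^p\,dx\Big)^{\frac{q(1+\varepsilon)}{p}}\Big)^{\frac{1}{q(1+\varepsilon)}}<\infty$$ (functions equal a.e. identified). *)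

(* Defs.v *)
From HB Require Import structures.
From mathcomp Require Import all_boot all_order all_algebra.
From mathcomp Require Import complex.
From mathcomp Require Import all_classical all_reals all_analysis.
Set Implicit Arguments. Unset Strict Implicit. Unset Printing Implicit Defensive.
Import Order.TTheory GRing.Theory Num.Theory.
Local Open Scope classical_set_scope.
Local Open Scope ring_scope.

Inductive index_set := XN | XN0 | XZ.

Definition inX (X : index_set) (k : int) : Prop :=
  match X with
  | XN => (1 <= k)%R
  | XN0 => (0 <= k)%R
  | XZ => True
  end.

Section GrandAmalgam.
Variable R : realType.

Definition cmod (z : R[i]) : R := Normc.normc z.

Definition Ik (k : int) : set R := `[(k%:~R : R), k%:~R + 1[%classic.

Definition Dom (X : index_set) : set R := \bigcup_(k in inX X) Ik k.

Definition locint (p : R) (g : R -> R[i]) (k : int) : \bar R :=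
  (\int[lebesgue_measure]_(x in Ik k) ((cmod (g x)) `^ p)%:E)%E.

Definition ga_norm_eps (X : index_set) (p q theta : R) (g : R -> R[i]) (eps : R)
  : \bar R :=
  ((((eps `^ theta)%:E *
      \esum_(k in inX X) poweR (locint p g k) (q * (1 + eps) / p))%E)
   `^ (1 / (q * (1 + eps))))%E.

Definition ga_norm (X : index_set) (p q theta : R) (g : R -> R[i]) : \bar R :=
  ereal_sup [set ga_norm_eps X p q theta g eps | eps in `]0, +oo[%classic].

Definition cmeasurable (D : set R) (g : R -> R[i]) : Prop :=
  measurable_fun D (fun x => complex.Re (g x)) /\
  measurable_fun D (fun x => complex.Im (g x)).

(* the space l^{q),theta}(L^p) (before identification of a.e. equal functions) *)
Definition grand_amalgam (X : index_set) (p q theta : R) : set (R -> R[i]) :=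
  [set g | cmeasurable (Dom X) g /\
           (forall k, inX X k -> (locint p g k < +oo)%E) /\
           (ga_norm X p q theta g < +oo)%E].

(* (L, N) is a complex Banach space of functions on D, where functions equal
   a.e. on D are identified: L is a complex vector space of functions,
   N is a norm on the quotient (N g = 0 iff g = 0 a.e. on D), and L is
   complete for N. *)
Definition Banach_ae (D : set R) (L : set (R -> R[i]))
    (N : (R -> R[i]) -> \bar R) : Prop :=
  [/\ L (fun _ => 0),
      (forall g h, L g -> L h -> L (fun x => (g x + h x)%R)) &
      (forall (c : R[i]) g, L g -> L (fun x => (c * g x)%R))] /\
  [/\ (forall g, L g -> (0 <= N g)%E /\ (N g < +oo)%E),
      (forall g, L g ->
         (N g = 0%E <-> {ae lebesgue_measure, forall x, D x -> g x = 0})),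
      (forall (c : R[i]) g, L g -> N (fun x => (c * g x)%R) = ((cmod c)%:E * N g)%E) &
      (forall g h, L g -> L h -> (N (fun x => (g x + h x)%R) <= N g + N h)%E)] /\
      (forall u : nat -> R -> R[i], (forall n, L (u n)) ->
        (forall e : R, 0 < e -> exists N0 : nat, forall m n, (N0 <= m)%N -> (N0 <= n)%N ->
            (N (fun x => (u n x - u m x)%R) < e%:E)%E) ->
        exists2 g, L g &
          forall e : R, 0 < e -> exists N0 : nat, forall n, (N0 <= n)%N ->
            (N (fun x => (u n x - g x)%R) < e%:E)%E).

End GrandAmalgam.

(* Main.v *)
Require Import Defs.
From mathcomp Require Import all_boot all_order all_algebra.
From mathcomp Require Import complex.
From mathcomp Require Import all_classical all_reals all_analysis.
From mathcomp Require Import measurable_realfun.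
Import Order.TTheory GRing.Theory Num.Theory.
Import numFieldNormedType.Exports.
Set Implicit Arguments.
Unset Strict Implicit.
Unset Printing Implicit Defensive.
Local Open Scope classical_set_scope.
Local Open Scope ring_scope.

(** A Banach function norm [rho] with the Fatou property makes the space of
    measurable functions [g] with [rho |g| < +oo] complete (Riesz-Fischer): the
    increments of a rapidly Cauchy subsequence have a series of finite norm, so
    this series is finite a.e. and the subsequence converges a.e.; the Fatou
    property then turns the Cauchy bounds into bounds on the distance to the
    limit.  The grand amalgam norm is such a norm, because the class of these
    norms contains the [L^p] norms and is stable under restriction to a subset,
    positive scaling, suprema and amalgams [sigma (k |-> rho_k f)]: it is the
    supremum over [eps] of multiples of the [l^(q (1 + eps))] amalgams of the
    [L^p] norms on the intervals [Ik k]. *)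

Section ereal_facts.
Local Open Scope ereal_scope.
Variable R : realType.
Implicit Types (x y : \bar R) (r : R) (A : set (\bar R)).

Lemma ge0_lee_poweR r x y : (0 <= r)%R -> 0 <= x -> x <= y -> x `^ r <= y `^ r.
Proof.
move=> r0 x0 xy; apply: gt0_ler_poweR => //; rewrite in_itv/= leey andbT//.
exact: le_trans xy.
Qed.

Lemma poweRK r x : (r != 0)%R -> 0 <= x -> (x `^ r) `^ r^-1 = x.
Proof. by move=> r0 x0; rewrite -poweRrM mulfV// poweRe1. Qed.

Lemma poweRVK r x : (r != 0)%R -> 0 <= x -> (x `^ r^-1) `^ r = x.
Proof. by move=> r0 x0; rewrite -poweRrM mulVf// poweRe1. Qed.

Lemma lee_poweR_inv r x y : (0 < r)%R -> 0 <= x -> 0 <= y ->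
  (x `^ r <= y) = (x <= y `^ r^-1).
Proof.
move=> r0 x0 y0; have rN0 : (r != 0)%R by rewrite gt_eqF.
have ri0 : (0 <= r^-1)%R by rewrite invr_ge0 ltW.
apply/idP/idP => [xry|xyr].
  by rewrite -(poweRK rN0 x0); apply: ge0_lee_poweR => //; exact: poweR_ge0.
by rewrite -(poweRVK rN0 y0); apply: ge0_lee_poweR => //; exact: ltW.
Qed.

Lemma poweR_ereal_sup r A : (0 < r)%R -> A !=set0 ->
  (forall x, A x -> 0 <= x) ->
  ereal_sup A `^ r = ereal_sup [set x `^ r | x in A].
Proof.
move=> r0 [x Ax] A0; have supA y : A y -> y <= ereal_sup A.
  exact: ereal_sup_ubound.
have supAr y : A y -> y `^ r <= ereal_sup [set x `^ r | x in A].
  by move=> Ay; apply: ereal_sup_ubound; exists y.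
have sup_ge0 : 0 <= ereal_sup A := le_trans (A0 x Ax) (supA x Ax).
have supr_ge0 : 0 <= ereal_sup [set x `^ r | x in A].
  exact: le_trans (poweR_ge0 _ _) (supAr x Ax).
apply/eqP; rewrite eq_le; apply/andP; split.
  rewrite lee_poweR_inv//; apply: ge_ereal_sup => y Ay.
  by rewrite -lee_poweR_inv ?supAr//; exact: A0.
apply: ge_ereal_sup => _ [y Ay <-].
by apply: ge0_lee_poweR; [exact: ltW|exact: A0|exact: supA].
Qed.

Lemma limn_einfE (u : (\bar R)^nat) : limn_einf u = ereal_sup (range (einfs u)).
Proof. by rewrite limn_einf_lim; exact/cvg_lim/cvg_einfs_sup. Qed.

Lemma einfs_ge0 (u : (\bar R)^nat) n : (forall m, 0 <= u m) -> 0 <= einfs u n.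
Proof. by move=> u0; apply: le_ereal_inf_tmp => _ [m _ <-]. Qed.

End ereal_facts.

Section nonneg_measurable.
Local Open Scope ereal_scope.
Context d (T : measurableType d) (R : realType).
Implicit Types (D E : set T) (f g : T -> \bar R).

Definition nonneg_measurable D f :=
  measurable_fun D f /\ forall x, D x -> 0 <= f x.

Lemma nonneg_measurable0 D : nonneg_measurable D (fun=> 0).
Proof. by split=> //; exact: measurable_cst. Qed.

Lemma nonneg_measurableS D E f : measurable E -> D `<=` E ->
  nonneg_measurable E f -> nonneg_measurable D f.
Proof.
move=> mE DE [mf f0]; split; first exact: measurable_funS DE mf.
by move=> x /DE; exact: f0.
Qed.

Lemma nonneg_measurable_restrict D f : measurable D ->
  nonneg_measurable D f -> nonneg_measurable setT (f \_ D).
Proof.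
move=> mD [mf f0]; split; first by apply/(measurable_restrictT _ mD).
by move=> x _; apply: erestrict_ge0.
Qed.

Lemma nonneg_measurableZ D (c : R) f : (0 <= c)%R -> nonneg_measurable D f ->
  nonneg_measurable D (fun x => c%:E * f x).
Proof.
move=> c0 [mf f0]; split; first exact: measurable_funeM.
by move=> x Dx; rewrite mule_ge0// f0.
Qed.

Lemma nonneg_measurableD D f g : nonneg_measurable D f ->
  nonneg_measurable D g -> nonneg_measurable D (f \+ g).
Proof.
move=> [mf f0] [mg g0]; split; first exact: emeasurable_funD.
by move=> x Dx; rewrite adde_ge0 ?f0 ?g0.
Qed.

Lemma nonneg_measurable_sum D (f : nat -> T -> \bar R) n :
  (forall i, nonneg_measurable D (f i)) ->
  nonneg_measurable D (fun x => \sum_(i < n) f i x).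
Proof.
move=> nf; split; first by apply: emeasurable_sum => i; case: (nf i).
by move=> x Dx; apply: sume_ge0 => i _; case: (nf i) => _; exact.
Qed.

Lemma nonneg_measurable_poweR D f (p : R) : nonneg_measurable D f ->
  nonneg_measurable D (fun x => f x `^ p).
Proof.
move=> [mf f0]; split=> [|x _]; last exact: poweR_ge0.
exact: (measurableT_comp (measurable_poweR _)).
Qed.

Lemma nonneg_measurable_ereal_sup D (f : (T -> \bar R)^nat) :
  (forall n, nonneg_measurable D (f n)) ->
  nonneg_measurable D (fun x => ereal_sup (range (f ^~ x))).
Proof.
move=> nf; split=> [|x Dx]; last first.
  apply: (@le_trans _ _ (f 0%N x)); first by case: (nf 0%N) => _; exact.
  by apply: ereal_sup_ubound; exists 0%N.
rewrite (_ : (fun _ => _) = (fun x => esups (f ^~ x) 0%N)).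
  by apply: measurable_fun_esups => n; case: (nf n).
by apply/funext => x; congr (ereal_sup [set _ | _ in _]); apply/seteqP.
Qed.

Lemma nonneg_measurable_einfs D (f : (T -> \bar R)^nat) n :
  (forall n, nonneg_measurable D (f n)) ->
  nonneg_measurable D (fun x => einfs (f ^~ x) n).
Proof.
move=> nf; split; first by apply: measurable_fun_einfs => m; case: (nf m).
by move=> x Dx; apply: einfs_ge0 => m; case: (nf m) => _; exact.
Qed.

End nonneg_measurable.

(* Banach function norms in the sense of Luxemburg, on functions that matter
   only on [D]; [fnorm_sup] is the Fatou property. *)
Record function_norm d (T : measurableType d) (R : realType)
    (mu : {measure set T -> \bar R}) (D : set T)
    (rho : (T -> \bar R) -> \bar R) : Prop := FunctionNorm {
  fnorm_ge0 : forall f, (0 <= rho f)%E ;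
  ae_le_fnorm : forall f g, nonneg_measurable D f -> nonneg_measurable D g ->
    {ae mu, forall x, D x -> (f x <= g x)%E} -> (rho f <= rho g)%E ;
  fnormZ : forall (c : R) f, 0 <= c -> nonneg_measurable D f ->
    rho (fun x => (c%:E * f x)%E) = (c%:E * rho f)%E ;
  fnormD : forall f g, nonneg_measurable D f -> nonneg_measurable D g ->
    (rho (f \+ g) <= rho f + rho g)%E ;
  fnorm_eq0_ae : forall f, nonneg_measurable D f -> rho f = 0%E ->
    {ae mu, forall x, D x -> f x = 0%E} ;
  fnorm_sup : forall f : (T -> \bar R)^nat,
    (forall n, nonneg_measurable D (f n)) ->
    (forall x, D x -> nondecreasing_seq (f ^~ x)) ->
    (rho (fun x => ereal_sup (range (f ^~ x))) <=
     ereal_sup (range (rho \o f)))%E }.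

Section function_norm_theory.
Local Open Scope ereal_scope.
Context d (T : measurableType d) (R : realType).
Variables (mu : {measure set T -> \bar R}) (D : set T).
Variable rho : (T -> \bar R) -> \bar R.
Hypotheses (rhoP : function_norm mu D rho) (mD : measurable D).
Implicit Types f g : T -> \bar R.

Lemma le_fnorm f g : nonneg_measurable D f -> nonneg_measurable D g ->
  (forall x, D x -> f x <= g x) -> rho f <= rho g.
Proof. by move=> nf ng fg; apply: (ae_le_fnorm rhoP) => //; exact: aeW. Qed.

Lemma fnorm0 : rho (fun=> 0) = 0.
Proof.
rewrite -[RHS](mul0e (rho (fun=> 0))).
rewrite -(fnormZ rhoP (lexx 0%R) (nonneg_measurable0 _ _)).
by congr rho; apply/funext => x; rewrite mul0e.
Qed.

Lemma fnorm_eq0P f : nonneg_measurable D f ->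
  rho f = 0 <-> {ae mu, forall x, D x -> f x = 0}.
Proof.
move=> nf; split; first exact: (fnorm_eq0_ae rhoP).
move=> f0; apply/eqP; rewrite eq_le (fnorm_ge0 rhoP) andbT -fnorm0.
apply: (ae_le_fnorm rhoP nf (nonneg_measurable0 _ _)).
by apply: filterS f0 => x /[apply] ->.
Qed.

(* The indicator of the set where [f] is infinite lies below every multiple
   of [f], so it has arbitrarily small norm. *)
Lemma fnorm_lty_ae f : nonneg_measurable D f -> rho f < +oo ->
  {ae mu, forall x, D x -> f x < +oo}.
Proof.
move=> nf rf; have [mf f0] := nf.
pose E := D `&` f @^-1` [set +oo]; pose h x := (\1_E x)%:E : \bar R.
have mE : measurable E by apply: mf => //; exact: emeasurable_set1.
have nh : nonneg_measurable D h.
  split=> [|x _]; last by rewrite lee_fin.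
  by apply/measurable_EFinP; exact: measurable_indic.
have rfin : rho f \is a fin_num by rewrite ge0_fin_numE ?(fnorm_ge0 rhoP).
have r0 : (0 <= fine (rho f))%R by rewrite fine_ge0// (fnorm_ge0 rhoP).
have rh0 : rho h = 0.
  apply/eqP; rewrite eq_le (fnorm_ge0 rhoP) andbT; apply/lee_addgt0Pr => e e0.
  have c0 : (0 < e / (fine (rho f) + 1))%R by rewrite divr_gt0// ltr_wpDl.
  apply: (@le_trans _ _ ((e / (fine (rho f) + 1))%:E * rho f)).
    rewrite -(fnormZ rhoP) ?(ltW c0)//; apply: le_fnorm => //.
      by apply: nonneg_measurableZ => //; exact: ltW.
    move=> x Dx; rewrite /h indicE; case: (boolP (x \in E)) => [|_].
      by rewrite inE => -[_ /= ->]; rewrite gt0_muley ?lte_fin// leey.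
    by rewrite mule_ge0 ?f0// lee_fin ltW.
  rewrite add0e -(fineK rfin) -EFinM lee_fin mulrAC ler_pdivrMr ?ltr_wpDl//.
  by rewrite ler_pM2l// lerDl.
apply: filterS (fnorm_eq0_ae rhoP nh rh0) => x hx Dx.
rewrite ltey; apply/eqP => fxoo; have := hx Dx.
by rewrite /h indicE mem_set// => -[] /eqP; rewrite oner_eq0.
Qed.

Lemma fnorm_sum_le (f : (T -> \bar R)^nat) n :
  (forall i, nonneg_measurable D (f i)) ->
  rho (fun x => \sum_(i < n) f i x) <= \sum_(i < n) rho (f i).
Proof.
move=> nf; elim: n => [|n IH].
  rewrite big_ord0 -[leRHS]fnorm0; apply: le_fnorm.
  - exact: (nonneg_measurable_sum 0).
  - exact: nonneg_measurable0.
  - by move=> x _; rewrite big_ord0.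
rewrite big_ord_recr/=; apply: le_trans (leeD IH (lexx _)).
have nS := nonneg_measurable_sum n nf.
rewrite -[X in rho X <= _](_ : (fun x => \sum_(i < n) f i x) \+ f n = _).
  exact: (fnormD rhoP).
by apply/funext => x; rewrite big_ord_recr.
Qed.

Lemma fnorm_series_lty_ae (f : (T -> \bar R)^nat) :
  (forall i, nonneg_measurable D (f i)) -> \sum_(i <oo) rho (f i) < +oo ->
  {ae mu, forall x, D x -> \sum_(i <oo) f i x < +oo}.
Proof.
move=> nf rf; pose S n x := \sum_(i < n) f i x.
have nS n : nonneg_measurable D (S n) by exact: nonneg_measurable_sum.
have ndS x : D x -> nondecreasing_seq (S ^~ x).
  move=> Dx; apply/nondecreasing_seqP => n; rewrite /S big_ord_recr/=.
  by rewrite leeDl//; case: (nf n) => _; exact.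
have supS : rho (fun x => ereal_sup (range (S ^~ x))) < +oo.
  apply: le_lt_trans rf; apply: le_trans (fnorm_sup rhoP nS ndS) _.
  apply: ge_ereal_sup => _ [n _ <-] /=.
  apply: le_trans (fnorm_sum_le n nf) _; rewrite -(big_mkord xpredT (rho \o f)).
  by apply: nneseries_lim_ge => i _ _; exact: (fnorm_ge0 rhoP).
apply: filterS (fnorm_lty_ae (nonneg_measurable_ereal_sup nS) supS).
move=> x Sx Dx; rewrite (cvg_lim _ (ereal_nondecreasing_cvgn _))//.
  rewrite (_ : (fun n => _) = S ^~ x); first exact: Sx.
  by apply/funext => n; rewrite /S big_mkord.
by apply: ereal_nondecreasing_series => n _ _; case: (nf n) => _; exact.
Qed.

Lemma fnorm_ae_cvg_le (f : (T -> \bar R)^nat) g (a : \bar R) :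
  (forall n, nonneg_measurable D (f n)) -> nonneg_measurable D g ->
  {ae mu, forall x, D x -> f n x @[n --> \oo] --> g x} ->
  (forall n, rho (f n) <= a) -> rho g <= a.
Proof.
move=> nf ng fg fa; pose h n x := einfs (f ^~ x) n.
have nh n : nonneg_measurable D (h n) by exact: nonneg_measurable_einfs.
apply: (@le_trans _ _ (rho (fun x => ereal_sup (range (h ^~ x))))).
  apply: (ae_le_fnorm rhoP) => //; first exact: nonneg_measurable_ereal_sup.
  apply: filterS fg => x /[apply] /cvg_limn_einf_sup[<- _].
  by rewrite limn_einfE.
apply: le_trans (fnorm_sup rhoP nh _) _.
  by move=> x _; exact: nondecreasing_einfs.
apply: ge_ereal_sup => _ [n _ <-] /=; apply: le_trans (fa n).
by apply: le_fnorm => // x _; apply: ereal_inf_lbound; exists n => /=.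
Qed.

End function_norm_theory.

Section function_norm_constructions.
Local Open Scope ereal_scope.
Context d (T : measurableType d) (R : realType).
Variable mu : {measure set T -> \bar R}.
Implicit Types (D : set T) (rho : (T -> \bar R) -> \bar R).

Lemma function_norm_scale D rho (c : R) : (0 < c)%R ->
  function_norm mu D rho -> function_norm mu D (fun f => c%:E * rho f).
Proof.
move=> c0 rhoP; have c_ge0 : (0 <= c)%R by exact: ltW.
split=> [f|f g nf ng fg|a f a0 nf|f g nf ng|f nf|f nf ndf].
- by rewrite mule_ge0// (fnorm_ge0 rhoP).
- by rewrite lee_pmul2l// (ae_le_fnorm rhoP).
- by rewrite (fnormZ rhoP)// muleCA.
- by rewrite -ge0_muleDr ?(fnorm_ge0 rhoP)// lee_pmul2l// (fnormD rhoP).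
- move=> /eqP; rewrite mule_eq0 eqe gt_eqF//= => /eqP.
  exact: (fnorm_eq0_ae rhoP).
- have rangeN0 : range (rho \o f) != set0.
    by apply/set0P; exists (rho (f 0%N)); exists 0%N.
  rewrite (_ : range _ = [set c%:E * x | x in range (rho \o f)]).
    by rewrite ereal_supZl// lee_pmul2l// (fnorm_sup rhoP).
  by rewrite image_comp.
Qed.

Lemma function_norm_restrict D rho : measurable D ->
  function_norm mu setT rho -> function_norm mu D (fun f => rho (f \_ D)).
Proof.
move=> mD rhoP; pose restrict_nm := nonneg_measurable_restrict mD.
split=> [f|f g nf ng fg|a f a0 nf|f g nf ng|f nf rf0|f nf ndf].
- exact: (fnorm_ge0 rhoP).
- apply: (ae_le_fnorm rhoP); [exact: restrict_nm|exact: restrict_nm|].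
  move: fg; apply: filterS => x fg _; rewrite /patch.
  by case: ifPn => // /set_mem; exact: fg.
- by rewrite erestrict_scale (fnormZ rhoP)//; exact: restrict_nm.
- by rewrite erestrictD (fnormD rhoP)//; exact: restrict_nm.
- have := fnorm_eq0_ae rhoP (restrict_nm _ _ nf) rf0.
  by apply: filterS => x /(_ Logic.I) + Dx; rewrite /patch mem_set.
- rewrite (_ : _ \_ D =
      (fun x => ereal_sup (range ((fun n => f n \_ D) ^~ x)))).
    apply: (fnorm_sup rhoP (f := fun n => f n \_ D)) => [n|x _ m n mn].
      exact: restrict_nm.
    by rewrite /patch; case: ifPn => // /set_mem Dx; exact: ndf.
  apply/funext => x; rewrite /patch; case: ifPn => // _.
  by rewrite ereal_sup_cst//; apply/set0P; exists 0%N.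
Qed.

Lemma function_norm_sup (I : Type) (J : set I) D
    (rho_ : I -> (T -> \bar R) -> \bar R) : J !=set0 ->
  (forall j, J j -> function_norm mu D (rho_ j)) ->
  function_norm mu D (fun f => ereal_sup [set rho_ j f | j in J]).
Proof.
move=> [i Ji] rhoP.
have ub j f : J j -> rho_ j f <= ereal_sup [set rho_ j f | j in J].
  by move=> Jj; apply: ereal_sup_ubound; exists j.
split=> [f|f g nf ng fg|a f a0 nf|f g nf ng|f nf rf0|f nf ndf].
- exact: le_trans (fnorm_ge0 (rhoP _ Ji) f) (ub _ _ Ji).
- apply: ge_ereal_sup => _ [j Jj <-]; apply: le_trans (ub _ _ Jj).
  exact: (ae_le_fnorm (rhoP _ Jj)).
- rewrite -ereal_supZl//; last by apply/set0P; exists (rho_ i f); exists i.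
  rewrite image_comp; congr ereal_sup; apply: eq_imagel => j Jj /=.
  exact: (fnormZ (rhoP _ Jj)).
- apply: ge_ereal_sup => _ [j Jj <-].
  exact: le_trans (fnormD (rhoP _ Jj) nf ng) (leeD (ub _ _ Jj) (ub _ _ Jj)).
- apply: (fnorm_eq0_ae (rhoP _ Ji) nf).
  by apply/eqP; rewrite eq_le (fnorm_ge0 (rhoP _ Ji)) andbT -rf0 ub.
- apply: ge_ereal_sup => _ [j Jj <-].
  apply: le_trans (fnorm_sup (rhoP _ Jj) nf ndf) _.
  apply: ge_ereal_sup => _ [n _ <-] /=; apply: le_trans (ub _ _ Jj) _.
  by apply: ereal_sup_ubound; exists n.
Qed.

Lemma ae_bigcup (D_ : nat -> set T) (P : T -> Prop) :
  {ae mu, forall x, (\bigcup_k D_ k) x -> P x} <->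
  forall k, {ae mu, forall x, D_ k x -> P x}.
Proof.
split=> [aeP k|/ae_foralln].
  by move: aeP; apply: filterS => x + Dx; apply; exists k.
by apply: filterS => x Px [k _ Dx]; exact: Px Dx.
Qed.

Lemma ae_counting (P : nat -> Prop) :
  {ae @counting _ R, forall k, P k} -> forall k, P k.
Proof.
move=> [A [_ + PA]] k; apply: contraPP => /PA Ak /=.
rewrite /counting; case: ifPn => // /asboolP finA /eqP.
rewrite eqe pnatr_eq0 finmap.cardfs_eq0 => /eqP A0.
by move: Ak; rewrite -(fset_setK finA) A0 set_fset0.
Qed.

Lemma function_norm_bigcup (D_ : nat -> set T)
    (rho_ : nat -> (T -> \bar R) -> \bar R)
    (sigma : (nat -> \bar R) -> \bar R) :
  (forall k, measurable (D_ k)) ->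
  (forall k, function_norm mu (D_ k) (rho_ k)) ->
  function_norm (@counting _ R) setT sigma ->
  function_norm mu (\bigcup_k D_ k) (fun f => sigma (fun k => rho_ k f)).
Proof.
move=> mD rhoP sigmaP.
have nS k (f : T -> \bar R) :
    nonneg_measurable (\bigcup_k D_ k) f -> nonneg_measurable (D_ k) f.
  by apply: nonneg_measurableS; [exact: bigcup_measurable|exact: bigcup_sup].
have nrho f : nonneg_measurable setT (fun k => rho_ k f).
  by split=> // k _; exact: (fnorm_ge0 (rhoP k)).
have sigma_le := le_fnorm sigmaP.
split=> [f|f g nf ng fg|a f a0 nf|f g nf ng|f nf sf0|f nf ndf].
- exact: (fnorm_ge0 sigmaP).
- apply: (sigma_le _ _ (nrho f) (nrho g)) => k _.
  apply: (ae_le_fnorm (rhoP k) (nS k _ nf) (nS k _ ng)).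
  by move/ae_bigcup : fg => /(_ k).
- rewrite -(fnormZ sigmaP)//; congr sigma; apply/funext => k.
  exact: (fnormZ (rhoP k) a0 (nS k _ nf)).
- apply: le_trans (fnormD sigmaP (nrho f) (nrho g)).
  apply: (sigma_le _ _ (nrho _) (nonneg_measurableD (nrho f) (nrho g))) => k _.
  exact: (fnormD (rhoP k) (nS k _ nf) (nS k _ ng)).
- apply/ae_bigcup => k; apply: (fnorm_eq0_ae (rhoP k) (nS k _ nf)).
  have := fnorm_eq0_ae sigmaP (nrho f) sf0.
  by move=> /ae_counting /(_ k); exact.
- have ndD k x : D_ k x -> nondecreasing_seq (f ^~ x).
    by move=> Dx; apply: ndf; exists k.
  apply: le_trans (fnorm_sup sigmaP (fun n => nrho (f n)) _).
    apply: (sigma_le _ _ (nrho _)) => [|k _].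
      exact: nonneg_measurable_ereal_sup (fun n => nrho (f n)).
    exact: (fnorm_sup (rhoP k) (fun n => nS k _ (nf n)) (@ndD k)).
  move=> k _ m n mn; apply: (le_fnorm (rhoP k)); [exact: nS|exact: nS|].
  by move=> x Dx; exact: (ndD k).
Qed.

End function_norm_constructions.

Lemma Lnorm_restrict d (T : measurableType d) (R : realType)
    (mu : {measure set T -> \bar R}) (p : R) (D : set T) (f : T -> \bar R) :
  p != 0 ->
  ('N[mu]_p%:E[f \_ D] = (\int[mu]_(x in D) `|f x| `^ p) `^ p^-1)%E.
Proof.
move=> p0; rewrite unlock [in RHS]integral_mkcond; congr (_ `^ _)%E.
apply: eq_integral => x _; rewrite /patch; case: ifPn => // _.
by rewrite abse0 poweR0r.
Qed.

Section Lnorm_function_norm.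
Local Open Scope ereal_scope.
Context d (T : measurableType d) (R : realType).
Variables (mu : {measure set T -> \bar R}) (p : R).
Hypothesis p1 : (1 <= p)%R.
Implicit Types f g : T -> \bar R.

Local Notation "'N_ p [ f ]" := (Lnorm mu p%:E f).

Let p0 : (0 < p)%R. Proof. exact: lt_le_trans p1. Qed.

Let pN0 : (p != 0)%R. Proof. by rewrite gt_eqF. Qed.

Lemma nonneg_LnormE f : nonneg_measurable setT f ->
  'N_p[f] = (\int[mu]_x f x `^ p) `^ p^-1.
Proof.
move=> [_ f0]; rewrite unlock; congr (_ `^ _).
by apply: eq_integral => x _; rewrite gee0_abs// f0.
Qed.

Lemma integral_poweR_ge0 f : 0 <= \int[mu]_x f x `^ p.
Proof. by apply: integral_ge0 => x _; exact: poweR_ge0. Qed.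

Lemma ae_le_Lnorm f g : nonneg_measurable setT f -> nonneg_measurable setT g ->
  {ae mu, forall x, f x <= g x} -> 'N_p[f] <= 'N_p[g].
Proof.
move=> nf ng fg; rewrite !nonneg_LnormE//.
apply: ge0_lee_poweR; [by rewrite invr_ge0 ltW|exact: integral_poweR_ge0|].
have [mfp fp0] := nonneg_measurable_poweR p nf.
have [mgp gp0] := nonneg_measurable_poweR p ng.
apply: ae_ge0_le_integral => //; move: fg; apply: filterS => x fg _.
by apply: ge0_lee_poweR fg; [exact: ltW|exact: nf.2].
Qed.

Lemma Lnorm_lty_ae_fin_num f : nonneg_measurable setT f -> 'N_p[f] < +oo ->
  {ae mu, forall x, f x \is a fin_num}.
Proof.
move=> nf; rewrite nonneg_LnormE// => Nf.
have [mfp fp0] := nonneg_measurable_poweR p nf.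
have ifp : mu.-integrable setT (fun x => f x `^ p).
  apply/integrableP; split=> //.
  under eq_integral do rewrite gee0_abs ?fp0//.
  by apply: lty_poweRy Nf; rewrite invr_eq0.
have := integrable_ae measurableT ifp; apply: filterS => x /(_ Logic.I).
rewrite !ge0_fin_numE ?fp0//; last by exact: nf.2.
exact: lty_poweRy.
Qed.

Lemma nonneg_minkowski f g :
  nonneg_measurable setT f -> nonneg_measurable setT g ->
  'N_p[f \+ g] <= 'N_p[f] + 'N_p[g].
Proof.
move=> nf ng; have [[mf f0] [mg g0]] := (nf, ng).
have [->|Nf] := eqVneq 'N_p[f] +oo.
  by rewrite addye ?leey// gt_eqF// (lt_le_trans ltNy0) ?Lnorm_ge0.
have [->|Ng] := eqVneq 'N_p[g] +oo.
  by rewrite addey ?leey// gt_eqF// (lt_le_trans ltNy0) ?Lnorm_ge0.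
have fine_nm h : nonneg_measurable setT h ->
    nonneg_measurable setT (EFin \o (fine \o h)).
  move=> [mh h0]; split=> [|x _]; last by rewrite lee_fin fine_ge0 ?h0.
  by apply/measurable_EFinP; exact: measurableT_comp.
have fine_le h : nonneg_measurable setT h ->
    'N_p[EFin \o (fine \o h)] <= 'N_p[h].
  move=> nh; apply: ae_le_Lnorm => //; first exact: fine_nm.
  by apply: aeW => x /=; case: (h x) (nh.2 x Logic.I) => //= _; rewrite leey.
apply: le_trans (leeD (fine_le _ nf) (fine_le _ ng)).
apply: le_trans (minkowski_EFin mu _ _ p1); last 2 first.
- exact: measurableT_comp.
- exact: measurableT_comp.
rewrite (_ : EFin \o _ = (EFin \o (fine \o f)) \+ (EFin \o (fine \o g)))//.
apply: ae_le_Lnorm.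
- exact: nonneg_measurableD.
- by apply: nonneg_measurableD; exact: fine_nm.
have [fin_f fin_g] := (Lnorm_lty_ae_fin_num nf, Lnorm_lty_ae_fin_num ng).
move: fin_f fin_g; rewrite !ltey => /(_ Nf) + /(_ Ng).
by apply: filterS2 => x fx gx /=; rewrite !fineK.
Qed.

Lemma nonneg_LnormZ (c : R) f : (0 <= c)%R -> nonneg_measurable setT f ->
  'N_p[(fun x => c%:E * f x)] = c%:E * 'N_p[f].
Proof.
move=> c0 nf; have [mfp fp0] := nonneg_measurable_poweR p nf.
rewrite !nonneg_LnormE//; last exact: nonneg_measurableZ.
rewrite (eq_integral (fun x => (c `^ p)%:E * f x `^ p)); last first.
  by move=> x _; rewrite poweRM ?lee_fin ?(nf.2 x).
rewrite ge0_integralZl_EFin ?powR_ge0//.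
rewrite poweRM ?integral_poweR_ge0 ?lee_fin ?powR_ge0//.
by rewrite -poweR_EFin poweRK.
Qed.

Lemma Lnorm_ereal_sup_le (f : (T -> \bar R)^nat) :
  (forall n, nonneg_measurable setT (f n)) ->
  (forall x, nondecreasing_seq (f ^~ x)) ->
  'N_p[(fun x => ereal_sup (range (f ^~ x)))] <=
  ereal_sup (range (fun n => 'N_p[f n])).
Proof.
move=> nf ndf; rewrite nonneg_LnormE; last exact: nonneg_measurable_ereal_sup.
have nfp n := nonneg_measurable_poweR p (nf n).
have ndfp x : nondecreasing_seq (fun n => f n x `^ p).
  move=> m n mn; apply: ge0_lee_poweR; [exact: ltW| |exact: ndf].
  by exact: (nf m).2.
rewrite (_ : \int[mu]_x _ = ereal_sup (range (fun n => \int[mu]_x f n x `^ p))).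
  rewrite poweR_ereal_sup ?invr_gt0//; last 2 first.
  - by eexists; exists 0%N.
  - by move=> _ [n _ <-]; exact: integral_poweR_ge0.
  by rewrite image_comp; under eq_imagel => n _ do rewrite /= -nonneg_LnormE//.
under eq_integral => x _.
  rewrite poweR_ereal_sup//; last 2 first.
  - by eexists; exists 0%N.
  - by move=> _ [n _ <-]; exact: (nf n).2.
  rewrite image_comp -(cvg_lim _ (ereal_nondecreasing_cvgn (ndfp x)))//; over.
rewrite monotone_convergence//; last 2 first.
- by move=> n; exact: (nfp n).1.
- by move=> n x _; exact: poweR_ge0.
apply/cvg_lim => //; apply: ereal_nondecreasing_cvgn => m n mn.
apply: ge0_le_integral => //; last by move=> x _; exact: ndfp.
- exact: (nfp m).2.
- exact: (nfp m).1.
- exact: (nfp n).1.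
Qed.

Lemma Lnorm_function_norm : function_norm mu setT (Lnorm mu p%:E).
Proof.
split=> [f|f g nf ng fg|||f nf Nf0|f nf ndf].
- exact: Lnorm_ge0.
- by apply: ae_le_Lnorm => //; move: fg; apply: filterS => x; exact.
- exact: nonneg_LnormZ.
- exact: nonneg_minkowski.
- by apply: (Lnorm_eq0_eq0 nf.1) Nf0; rewrite lte_fin.
- by apply: Lnorm_ereal_sup_le => // x; exact: ndf.
Qed.

End Lnorm_function_norm.

Section complex_functions.
Variable R : realType.
Implicit Types (z w : R[i]) (D : set R) (g h : R -> R[i]).

Lemma cmod_ge0 z : 0 <= cmod z.
Proof. by case: z => a b; exact: sqrtr_ge0. Qed.

Lemma cmod_eq0 z : cmod z = 0 <-> z = 0.
Proof. by split=> [/Normc.eq0_normc//|->]; exact: Normc.normc0. Qed.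

Lemma cmodE z : cmod z = Num.sqrt (complex.Re z ^+ 2 + complex.Im z ^+ 2).
Proof. by case: z. Qed.

Lemma Re_le_cmod z : `|complex.Re z| <= cmod z.
Proof. by rewrite cmodE -sqrtr_sqr ler_wsqrtr// lerDl sqr_ge0. Qed.

Lemma Im_le_cmod z : `|complex.Im z| <= cmod z.
Proof. by rewrite cmodE -sqrtr_sqr ler_wsqrtr// lerDr sqr_ge0. Qed.

Lemma cmeasurable0 D : cmeasurable D (fun=> 0).
Proof. by split; exact: measurable_cst. Qed.

Lemma cmeasurableD D g h : cmeasurable D g -> cmeasurable D h ->
  cmeasurable D (fun x => g x + h x).
Proof.
by move=> [gr gi] [hr hi]; split; under eq_fun do rewrite raddfD;
  exact: measurable_funD.
Qed.

Lemma cmeasurableZ D c g : cmeasurable D g -> cmeasurable D (fun x => c * g x).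
Proof.
case: c => a b [gr gi]; split.
- rewrite (_ : (fun _ => _) =
    (fun x => a * complex.Re (g x) - b * complex.Im (g x))).
    by apply: measurable_funB; apply: measurable_funM.
  by apply/funext => x; case: (g x).
- rewrite (_ : (fun _ => _) =
    (fun x => a * complex.Im (g x) + b * complex.Re (g x))).
    by apply: measurable_funD; apply: measurable_funM.
  by apply/funext => x; case: (g x).
Qed.

Lemma cmeasurableB D g h : cmeasurable D g -> cmeasurable D h ->
  cmeasurable D (fun x => g x - h x).
Proof.
by move=> [gr gi] [hr hi]; split; under eq_fun do rewrite raddfB;
  exact: measurable_funB.
Qed.

Definition ecmod g x : \bar R := (cmod (g x))%:E.

Lemma nonneg_measurable_ecmod D g : cmeasurable D g ->
  nonneg_measurable D (ecmod g).
Proof.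
move=> [gr gi]; split=> [|x _]; last by rewrite lee_fin cmod_ge0.
apply/measurable_EFinP; under eq_fun do rewrite cmodE.
apply: measurableT_comp.
  by apply: continuous_measurable_fun; exact: sqrt_continuous.
by apply: measurable_funD; exact: measurable_funX.
Qed.

(* Upper limits exist everywhere, so measurability holds without any
   assumption of convergence; [fine] returns [0] where they are infinite. *)
Definition limsup_complex (v : nat -> R -> R[i]) (x : R) : R[i] :=
  (fine (limn_esup (fun n => (complex.Re (v n x))%:E)) +i*
   fine (limn_esup (fun n => (complex.Im (v n x))%:E)))%C.

Lemma cmeasurable_limsup_complex D (v : nat -> R -> R[i]) :
  (forall n, cmeasurable D (v n)) -> cmeasurable D (limsup_complex v).
Proof.
move=> mv; split; apply: (measurableT_comp (@fine_measurable R _ measurableT)).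
- apply: (measurable_fun_limn_esup (f := fun n x => (complex.Re (v n x))%:E)).
  by move=> n; apply/measurable_EFinP; exact: (mv n).1.
- apply: (measurable_fun_limn_esup (f := fun n x => (complex.Im (v n x))%:E)).
  by move=> n; apply/measurable_EFinP; exact: (mv n).2.
Qed.

Lemma cvg_fine_limn_esup (u : R^nat) : cvgn u ->
  u n @[n --> \oo] --> fine (limn_esup (EFin \o u)).
Proof.
move=> /cvg_ex[l ul]; have /cvg_limn_einf_sup[_ ->] // :
  (EFin \o u) n @[n --> \oo] --> l%:E.
by apply: cvg_EFin => //; exact: nearW.
Qed.

Lemma cvgn_summable_increments (u b : R^nat) :
  (forall n, `|u n.+1 - u n| <= b n) -> (\sum_(n <oo) (b n)%:E < +oo)%E ->
  cvgn u.
Proof.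
move=> ub sb; have b0 n : 0 <= b n := le_trans (normr_ge0 _) (ub n).
have cb : cvgn (series b).
  apply: nondecreasing_is_cvgn.
    by apply: nondecreasing_series => n _ _; exact: b0.
  exists (fine (\sum_(n <oo) (b n)%:E)%E) => _ [n _ <-].
  rewrite -lee_fin fineK; last first.
    by rewrite ge0_fin_numE// nneseries_ge0// => i _ _; exact: b0.
  by rewrite /series/= -sumEFin; apply: nneseries_lim_ge => i _ _; exact: b0.
have : cvgn (series (telescope u)).
  by apply: normed_cvg; apply: series_le_cvg cb => //= n.
rewrite telescopeK => cu.
rewrite (_ : u = (fun n => u n - u 0%N) + cst (u 0%N)).
  by apply: is_cvgD => //; exact: is_cvg_cst.
by apply/funext => n; rewrite /= subrK.
Qed.

Lemma cvg_cmodB (z_ : nat -> R[i]) z w :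
  complex.Re (z_ n) @[n --> \oo] --> complex.Re z ->
  complex.Im (z_ n) @[n --> \oo] --> complex.Im z ->
  cmod (w - z_ n) @[n --> \oo] --> cmod (w - z).
Proof.
move=> zr zi; rewrite cmodE; under eq_fun do rewrite cmodE.
apply: (@continuous_cvg _ _ _ _ _ _ (@Num.sqrt R)).
  exact: sqrt_continuous.
rewrite !raddfB !expr2; under eq_fun do rewrite !raddfB !expr2.
by apply: cvgD; apply: cvgM; apply: cvgB => //; exact: cvg_cst.
Qed.

Lemma cvg_cmodB_limsup_complex (v : nat -> R -> R[i]) x w :
  (\sum_(n <oo) ecmod (fun y => v n.+1 y - v n y)%R x < +oo)%E ->
  cmod (w - v n x) @[n --> \oo] --> cmod (w - limsup_complex v x).
Proof.
move=> vx; apply: cvg_cmodB; apply: cvg_fine_limn_esup;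
  apply: cvgn_summable_increments vx => n; rewrite -raddfB.
- exact: Re_le_cmod.
- exact: Im_le_cmod.
Qed.

End complex_functions.

Lemma rapidly_cauchy_subsequence (R : realType) (dist : nat -> nat -> \bar R) :
  (forall e : R, 0 < e -> exists n0 : nat, forall m n, (n0 <= m)%N ->
    (n0 <= n)%N -> (dist n m < e%:E)%E) ->
  exists2 phi : nat -> nat, (forall n, (n <= phi n)%N) &
    forall n, (dist (phi n.+1) (phi n) <= (1 / (2 ^ n.+1)%:R)%:E)%E.
Proof.
move=> cauchy.
have /choice[n0 n0P] : forall j : nat, exists n0 : nat, forall m n,
    (n0 <= m)%N -> (n0 <= n)%N -> (dist n m < (1 / (2 ^ j.+1)%:R)%:E)%E.
  by move=> j; apply: cauchy; rewrite divr_gt0// ltr0n expn_gt0.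
pose phi n := \max_(i < n.+1) maxn i (n0 i).
have phi_ge i n : (i <= n)%N -> (maxn i (n0 i) <= phi n)%N.
  rewrite -ltnS => i_n.
  exact: (@leq_bigmax _ (fun i : 'I_n.+1 => maxn i (n0 i)) (Ordinal i_n)).
exists phi => n; first exact: leq_trans (leq_maxl _ _) (phi_ge n n (leqnn n)).
apply/ltW/n0P.
- exact: leq_trans (leq_maxr _ _) (phi_ge n n (leqnn n)).
- exact: leq_trans (leq_maxr _ _) (phi_ge n n.+1 (leqnSn n)).
Qed.

Section complex_function_space.
Local Open Scope ereal_scope.
Variables (R : realType) (mu : {measure set (measurableTypeR R) -> \bar R}).
Variables (D : set R) (rho : (R -> \bar R) -> \bar R).
Hypotheses (rhoP : function_norm mu D rho) (mD : measurable D).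
Implicit Types (g h : R -> R[i]) (u v : nat -> R -> R[i]).

Definition cfunction_space : set (R -> R[i]) :=
  [set g | cmeasurable D g /\ rho (ecmod g) < +oo].

Local Notation N g := (rho (ecmod g)).

Lemma cfnormZ (c : R[i]) g : cmeasurable D g ->
  N (fun x => c * g x)%R = (cmod c)%:E * N g.
Proof.
move=> mg; have ng := nonneg_measurable_ecmod mg.
rewrite -(fnormZ rhoP) ?cmod_ge0//; congr rho; apply/funext => x.
by rewrite /ecmod -EFinM; congr EFin; exact: Normc.normcM.
Qed.

Lemma cfnormD g h : cmeasurable D g -> cmeasurable D h ->
  N (fun x => g x + h x)%R <= N g + N h.
Proof.
move=> mg mh; have ng := nonneg_measurable_ecmod mg.
have nh := nonneg_measurable_ecmod mh.
apply: le_trans (fnormD rhoP ng nh); apply: (le_fnorm rhoP).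
- by apply: nonneg_measurable_ecmod; exact: cmeasurableD.
- exact: nonneg_measurableD.
- by move=> x _; rewrite lee_fin; exact: le_normcD.
Qed.

Lemma cfnorm_eq0 g : cmeasurable D g ->
  N g = 0 <-> {ae mu, forall x, D x -> g x = 0%R}.
Proof.
move=> mg; rewrite (fnorm_eq0P rhoP (nonneg_measurable_ecmod mg)).
split.
- by apply: filterS => x /[apply] -[/cmod_eq0].
- apply: (@filterS _ (almost_everywhere mu)) => x /[apply] gx0.
  by congr EFin; exact/cmod_eq0.
Qed.

Lemma cfunction_space0 : cfunction_space (fun=> 0%R).
Proof.
split; first exact: cmeasurable0.
suff -> : N (fun=> 0%R) = 0 by [].
by apply/cfnorm_eq0; [exact: cmeasurable0|exact: aeW].
Qed.

Lemma cfunction_spaceD g h : cfunction_space g -> cfunction_space h ->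
  cfunction_space (fun x => g x + h x)%R.
Proof.
move=> [mg Ng] [mh Nh]; split; first exact: cmeasurableD.
exact: le_lt_trans (cfnormD mg mh) (lte_add_pinfty Ng Nh).
Qed.

Lemma cfunction_spaceZ (c : R[i]) g : cfunction_space g ->
  cfunction_space (fun x => c * g x)%R.
Proof.
move=> [mg Ng]; split; first exact: cmeasurableZ.
by rewrite cfnormZ// lte_mul_pinfty ?lee_fin ?cmod_ge0.
Qed.

Lemma cfnorm_limsup_le v (w : R -> R[i]) (a : \bar R) n0 :
  (forall n, cmeasurable D (v n)) -> cmeasurable D w ->
  \sum_(n <oo) N (fun x => v n.+1 x - v n x)%R < +oo ->
  (forall n, (n0 <= n)%N -> N (fun x => w x - v n x)%R <= a) ->
  N (fun x => w x - limsup_complex v x)%R <= a.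
Proof.
move=> mv mw sv wva.
pose dist n := ecmod (fun x => w x - v (n + n0)%N x)%R.
apply: (fnorm_ae_cvg_le rhoP (f := dist)).
- by move=> n; apply: nonneg_measurable_ecmod; exact: cmeasurableB.
- apply: nonneg_measurable_ecmod; apply: cmeasurableB => //.
  exact: cmeasurable_limsup_complex.
- have := fnorm_series_lty_ae rhoP mD
    (fun n => nonneg_measurable_ecmod (cmeasurableB (mv n.+1) (mv n))) sv.
  apply: filterS => x /[apply] vx; apply: cvg_EFin; first exact: nearW.
  by have := cvg_cmodB_limsup_complex (w := w x) vx; rewrite -(cvg_shiftn n0).
- by move=> n; apply: wva; rewrite leq_addl.
Qed.

Lemma cfunction_space_complete u : (forall n, cfunction_space (u n)) ->
  (forall e : R, (0 < e)%R -> exists n0 : nat, forall m n, (n0 <= m)%N ->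
    (n0 <= n)%N -> N (fun x => u n x - u m x)%R < e%:E) ->
  exists2 g, cfunction_space g &
    forall e : R, (0 < e)%R -> exists n0 : nat, forall n, (n0 <= n)%N ->
      N (fun x => u n x - g x)%R < e%:E.
Proof.
move=> Lu cu; have um n : cmeasurable D (u n) by case: (Lu n).
have [phi phi_ge phiP] := rapidly_cauchy_subsequence cu.
pose v n := u (phi n); pose g := limsup_complex v.
have mg : cmeasurable D g by apply: cmeasurable_limsup_complex => n; exact: um.
have sv : \sum_(n <oo) N (fun x => v n.+1 x - v n x)%R < +oo.
  apply: le_lt_trans (ltry 1); apply: le_trans (epsilon_trick0 xpredT ler01).
  by apply: lee_nneseries => n _ *; [exact: (fnorm_ge0 rhoP)|exact: phiP].
have cvg_u e : (0 < e)%R -> exists n0 : nat, forall n, (n0 <= n)%N ->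
    N (fun x => u n x - g x)%R < e%:E.
  move=> e0; have [|n0 un0] := cu (e / 2)%R; first by rewrite divr_gt0.
  exists n0 => n n0n; apply: (@le_lt_trans _ _ (e / 2)%:E); last first.
    by rewrite lte_fin ltr_pdivrMr// ltr_pMr// ltr1n.
  apply: (cfnorm_limsup_le (n0 := n0)) => // [m|m n0m]; first exact: um.
  by apply/ltW/un0 => //; exact: leq_trans (phi_ge m).
exists g => //; have [n0 /(_ _ (leqnn n0)) ugn0] := cvg_u 1%R ltr01.
rewrite (_ : g = (fun x => u n0 x + (-1) * (u n0 x - g x))%R).
  apply: cfunction_spaceD => //; apply: cfunction_spaceZ; split.
    exact: cmeasurableB.
  exact: lt_trans ugn0 (ltry 1).
by apply/funext => x; rewrite mulN1r opprB addrC subrK.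
Qed.

End complex_function_space.

Lemma Banach_ae_cfunction_space (R : realType) (D : set R)
    (rho : (R -> \bar R) -> \bar R) : measurable D ->
  function_norm lebesgue_measure D rho ->
  Banach_ae D (cfunction_space D rho) (fun g => rho (ecmod g)).
Proof.
move=> mD rhoP; split; first split.
- exact: cfunction_space0 rhoP.
- exact: cfunction_spaceD rhoP.
- exact: cfunction_spaceZ rhoP.
split; last exact: cfunction_space_complete rhoP mD.
split.
- by move=> g [_ Ng]; split=> //; exact: (fnorm_ge0 rhoP).
- by move=> g [mg _]; exact: cfnorm_eq0 rhoP g mg.
- by move=> c g [mg _]; exact: cfnormZ rhoP c g mg.
- by move=> g h [mg _] [mh _]; exact: cfnormD rhoP g h mg mh.
Qed.

Section grand_amalgam_norm.
Local Open Scope ereal_scope.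
Variable R : realType.
Implicit Types (X : index_set) (p q r theta : R) (g : R -> R[i]).

(* A sequential enumeration of the [Ik k], [k] in [X], by [pickle]: the indices
   that encode no such [k] get the empty set and contribute nothing. *)
Definition interval_seq X (n : nat) : set R :=
  if pickle_inv n is Some k then [set x | inX X k /\ Ik k x] else set0.

Lemma interval_seq_pickle X k : inX X k -> interval_seq X (pickle k) = Ik k.
Proof.
by move=> Xk; rewrite /interval_seq pickleK_inv; apply/seteqP; split=> [x []|].
Qed.

Lemma interval_seq_set0 X n : ~ (pickle @` inX X) n -> interval_seq X n = set0.
Proof.
move=> nX; rewrite /interval_seq; have := @pickle_invK int n.
case: pickle_inv => // k /= kn; apply/seteqP; split=> // x [Xk _].
by apply: nX; exists k.
Qed.

Lemma bigcup_interval_seq X : \bigcup_n interval_seq X n = Dom X.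
Proof.
apply/seteqP; split=> [x [n _]|x [k Xk kx]].
  by rewrite /interval_seq; case: pickle_inv => // k [Xk kx]; exists k.
by exists (pickle k) => //; rewrite interval_seq_pickle.
Qed.

Lemma measurable_interval_seq X n : measurable (interval_seq X n).
Proof.
rewrite /interval_seq; case: pickle_inv => [k|]; last exact: measurable0.
have [Xk|nXk] := pselect (inX X k).
  rewrite (_ : [set x | _] = Ik k); first exact: measurable_itv.
  by apply/seteqP; split=> [x []|].
rewrite (_ : [set x | _] = set0); first exact: measurable0.
by apply/seteqP; split=> [x []|].
Qed.

Lemma measurable_Dom X : measurable (@Dom R X).
Proof.
rewrite -bigcup_interval_seq; apply: bigcup_measurable => n _.
exact: measurable_interval_seq.
Qed.

Definition amalgam_norm X p r (f : R -> \bar R) :=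
  'N[counting]_r%:E[(fun n =>
    'N[lebesgue_measure]_p%:E[f \_ (interval_seq X n)])].

Lemma function_norm_amalgam X p r : (1 <= p)%R -> (1 <= r)%R ->
  function_norm lebesgue_measure (Dom X) (amalgam_norm X p r).
Proof.
move=> p1 r1; rewrite -bigcup_interval_seq.
apply: (function_norm_bigcup (sigma := Lnorm counting r%:E)).
- exact: measurable_interval_seq.
- move=> n; apply: function_norm_restrict; first exact: measurable_interval_seq.
  exact: Lnorm_function_norm.
- exact: Lnorm_function_norm.
Qed.

Lemma Lnorm_locint p g k : (0 < p)%R ->
  'N[lebesgue_measure]_p%:E[ecmod g \_ (Ik k)] = locint p g k `^ p^-1.
Proof.
move=> p0; rewrite Lnorm_restrict ?gt_eqF//; congr (_ `^ _).
by apply: eq_integral => x _; rewrite gee0_abs// lee_fin cmod_ge0.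
Qed.

Lemma amalgam_norm_esum X p r g : (0 < p)%R -> (0 < r)%R ->
  amalgam_norm X p r (ecmod g) =
  (\esum_(k in inX X) locint p g k `^ (r / p)) `^ r^-1.
Proof.
move=> p0 r0; rewrite /amalgam_norm Lnorm_counting//; congr (_ `^ _).
rewrite nneseries_esumT; last by move=> n; exact: poweR_ge0.
rewrite (esumID (pickle @` inX X)) => [|n _]; last exact: poweR_ge0.
rewrite !setTI [X in _ + X]esum1 ?adde0; last first.
  move=> n /interval_seq_set0 ->.
  by rewrite erestrict_set0 Lnorm0 ?eqe ?gt_eqF// abse0 poweR0r// gt_eqF.
rewrite esum_image; last by move=> k l _ _; exact: (pcan_inj pickleK).
apply: eq_esum => k Xk; rewrite interval_seq_pickle// Lnorm_locint//.
by rewrite gee0_abs ?poweR_ge0// -poweRrM mulrC.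
Qed.

Definition grand_norm X p q theta (f : R -> \bar R) :=
  ereal_sup [set ((eps `^ theta) `^ (q * (1 + eps))^-1)%:E *
    amalgam_norm X p (q * (1 + eps)) f | eps in `]0%R, +oo[].

Lemma function_norm_grand X p q theta : (1 <= p)%R -> (1 <= q)%R ->
  function_norm lebesgue_measure (Dom X) (grand_norm X p q theta).
Proof.
move=> p1 q1; apply: function_norm_sup => [|eps /=].
  by exists 1%R; rewrite /= in_itv/= ltr01.
rewrite in_itv/= andbT => eps0.
apply: function_norm_scale; first by rewrite !powR_gt0.
apply: function_norm_amalgam => //.
by rewrite -[leLHS]mulr1 ler_pM// lerDl ltW.
Qed.

Lemma grand_normE X p q theta g : (0 < p)%R -> (0 < q)%R ->
  grand_norm X p q theta (ecmod g) = ga_norm X p q theta g.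
Proof.
move=> p0 q0; congr ereal_sup; apply: eq_imagel => eps /=.
rewrite in_itv/= andbT => eps0.
have r0 : (0 < q * (1 + eps))%R by rewrite mulr_gt0// addr_gt0.
rewrite amalgam_norm_esum// /ga_norm_eps div1r -poweR_EFin.
rewrite poweRM ?lee_fin ?powR_ge0//.
by apply: esum_ge0 => k _; exact: poweR_ge0.
Qed.

(* At [eps = 1] the weight is [1], so each local norm is a summand of a finite
   sum. *)
Lemma locint_lty X p q theta g k : (0 < p)%R -> (0 < q)%R -> inX X k ->
  ga_norm X p q theta g < +oo -> locint p g k < +oo.
Proof.
move=> p0 q0 Xk; have r0 : (0 < q * (1 + 1))%R by rewrite mulr_gt0.
have le1 : ga_norm_eps X p q theta g 1 <= ga_norm X p q theta g.
  by apply: ereal_sup_ubound; exists 1%R; rewrite //= in_itv/= ltr01.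
move=> /(le_lt_trans le1); rewrite /ga_norm_eps powR1 mul1e div1r.
move=> /lty_poweRy; rewrite invr_eq0 gt_eqF// => /(_ isT) sum_lty.
apply: (@lty_poweRy _ _ (q * (1 + 1) / p)).
  by rewrite mulf_neq0 ?invr_eq0 ?gt_eqF.
apply: le_lt_trans sum_lty; apply: esum_ge; exists [set k].
  by split; [exact: finite_set1|move=> _ ->].
by rewrite fsbig_set1.
Qed.

Lemma grand_amalgamE X p q theta : (0 < p)%R -> (0 < q)%R ->
  grand_amalgam X p q theta =
  cfunction_space (Dom X) (grand_norm X p q theta).
Proof.
move=> p0 q0; apply/seteqP.
split=> g; rewrite /cfunction_space /= grand_normE//.
  by move=> [mg [_ Ng]].
move=> [mg Ng]; split=> //; split=> // k Xk.
exact: locint_lty Ng.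
Qed.

End grand_amalgam_norm.

Theorem theorem2p4 (R : realType) (X : index_set) (p q theta : R) :
  0 < theta -> 1 <= p -> 1 <= q ->
  Banach_ae (Dom X) (grand_amalgam X p q theta) (ga_norm X p q theta).
Proof.
move=> _ p1 q1; have p0 : 0 < p by exact: lt_le_trans p1.
have q0 : 0 < q by exact: lt_le_trans q1.
rewrite grand_amalgamE//.
rewrite (_ : ga_norm X p q theta = fun g => grand_norm X p q theta (ecmod g)).
  apply: Banach_ae_cfunction_space; first exact: measurable_Dom.
  exact: function_norm_grand.
by apply/funext => g; rewrite grand_normE.
Qed.
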